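(* Let $(\mathcal X,d)$ be a metric space and $F=\{f_1,\dots,f_r\}\subset C(\mathcal X,\mathcal X)$ with $r\ge2$. For a word $u=i_k\cdots i_1\in[r]^k$ write $f_u:=f_{i_k}\circ\cdots\circ f_{i_1}$. Assume: (1) for every $k$, the map $u\mapsto f_u$ is injective on words $u\in[r]^k$; (2) there exist $x_\ast\in\mathcal X$ and $\delta>0$ such that for all $k$ and all distinct words $u,v$ of length $k$, $d\big(f_u(x_\ast),f_v(x_\ast)\big)\ge\delta$. Then, for every $k$ and every $0<\varepsilon<\delta/2$, $$N\big(B(k,F),d_\infty,\varepsilon\big)\ge r^k .$$
   Context: $[r]=\{1,\dots,r\}$. $C(\mathcal X,\mathcal X)$ is the set of continuous self-maps; $d_\infty(f,g)=\sup_xd(f(x),g(x))$ (possibly infinite). $B(k,F)$ is the set of all compositions of at most $k$ maps from $F$ (including the identity). $N(A,\rho,\varepsilon)$ is the covering number: the least number (possibly $\infty$) of open $\rho$-balls of radius $\varepsilon$, with centers in the ambient space $C(\mathcal X,\mathcal X)$, covering $A$. *)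

(* Defs.v *)
From HB Require Import structures.
From mathcomp Require Import all_boot all_order all_algebra.
From mathcomp Require Import all_classical all_reals all_analysis.

Set Implicit Arguments.
Unset Strict Implicit.
Unset Printing Implicit Defensive.

Import Order.TTheory GRing.Theory Num.Theory.

Local Open Scope classical_set_scope.
Local Open Scope ring_scope.

(* [:: g_1; ...; g_n] |-> g_1 \o ... \o g_n: the head is applied last. *)
Definition comp_seq (X : topologicalType) (s : seq (continuousType X X)) :
    continuousType X X :=
  foldr (fun g h : continuousType X X => g \o h : continuousType X X)
        (idfun : continuousType X X) s.

(* A word i_k ... i_1 is the tuple [tuple i_k; ...; i_1], with letters in
   {0, ..., r - 1}; it is sent to f_{i_k} \o ... \o f_{i_1}. *)
Definition word_map (X : topologicalType) (r : nat)
    (f : 'I_r -> continuousType X X) (k : nat) (u : k.-tuple 'I_r) :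
    continuousType X X :=
  comp_seq (map f u).

(* B(k, F); the empty composition is the identity. *)
Definition word_ball (X : topologicalType) (k : nat)
    (F : set (continuousType X X)) : set (continuousType X X) :=
  [set comp_seq s | s in [set s : seq (continuousType X X) |
                            (size s <= k)%N /\ [set` s] `<=` F]].

(* The supremum is taken in \bar R, so it may be +oo (and it is -oo, not 0,
   when X is empty). *)
Definition dist_sup (R : realType) (X : metricType R)
    (f g : continuousType X X) : \bar R :=
  ereal_sup (range (fun x : X => (mdist (f x) (g x))%:E)).

(* Centers range over the whole type T, not only over A.  A minimal cover never
   repeats a center, so families indexed by 'I_n give the usual least
   cardinality; the infimum is +oo when there is no finite cover. *)
Definition covering_number (R : realType) (T : Type) (A : set T)
    (rho : T -> T -> \bar R) (eps : R) : \bar R :=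
  ereal_inf [set n%:R%:E | n in [set n : nat | exists c : 'I_n -> T,
    A `<=` \bigcup_(i in [set: 'I_n]) [set y | (rho (c i) y < eps%:E)%E]]].

(* Main.v *)
Require Import Defs.
From HB Require Import structures.
From mathcomp Require Import all_boot all_order all_algebra.
From mathcomp Require Import all_classical all_reals all_analysis.

(** Evaluation at [xstar] is 1-Lipschitz from the uniform distance to [X], so
    two words of length [k] lying in the same ball of radius [eps < delta / 2]
    would have values at [xstar] less than [delta] apart.  Hence a cover
    assigns distinct balls to the [r ^ k] words. *)

Import Order.TTheory GRing.Theory Num.Theory.

Local Open Scope classical_set_scope.
Local Open Scope ring_scope.

(** Choosing for each [i] a ball that contains [s i] gives an injection from [I] into the index set
    of any finite cover; without a finite cover the infimum is [+oo]. *)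
Lemma card_le_covering_number (R : realType) (T : Type) (A : set T)
    (rho : T -> T -> \bar R) (eps : R) (I : finType) (s : I -> T) :
  (forall i, A (s i)) ->
  (forall c i j, (rho c (s i) < eps%:E)%E -> (rho c (s j) < eps%:E)%E ->
     i = j) ->
  (#|I|%:R%:E <= covering_number A rho eps)%E.
Proof.
move=> As sep; apply: le_ereal_inf_tmp => _ [n [c cover] <-].
have /choice[g gP] i : exists j, (rho (c j) (s i) < eps%:E)%E.
  by have [j _ ?] := cover _ (As i); exists j.
have g_inj : injective g.
  (* Equal indices put [s i] and [s j] in the same ball, centered at [c (g i)]. *)
  by move=> i j gij; apply: (sep (c (g i))); rewrite ?{2}gij //= gij.
by rewrite lee_fin ler_nat -[n in (_ <= n)%N]card_ord (leq_card g).
Qed.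

Lemma mdist_le_dist_sup (R : realType) (X : metricType R)
    (f g : continuousType X X) (x : X) :
  ((mdist (f x) (g x))%:E <= dist_sup f g)%E.
Proof. by apply: ereal_sup_ubound; exists x. Qed.

Lemma word_ball_word_map (X : topologicalType) (r : nat)
    (f : 'I_r -> continuousType X X) (k : nat) (u : k.-tuple 'I_r) :
  word_ball k (range f) (word_map f u).
Proof.
exists (map f u) => //; split; first by rewrite size_map size_tuple.
by move=> g /= /mapP[i _ ->]; exists i.
Qed.

Theorem mainTheorem7 (R : realType) (X : metricType R) (r : nat)
    (f : 'I_r -> continuousType X X) (r_ge2 : (2 <= r)%N)
    (word_inj : forall k : nat,
      injective (fun u : k.-tuple 'I_r => word_map f u))
    (xstar : X) (delta : R) (delta_gt0 : 0 < delta)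
    (word_sep : forall (k : nat) (u v : k.-tuple 'I_r), u <> v ->
      delta <= mdist (word_map f u xstar) (word_map f v xstar))
    (k : nat) (eps : R) (eps_gt0 : 0 < eps) (eps_lt : eps < delta / 2) :
  ((r ^ k)%N%:R%:E <= covering_number (word_ball k (range f))
                        (@dist_sup R X) eps)%E.
Proof.
have -> : (r ^ k)%N = #|{: k.-tuple 'I_r}| by rewrite card_tuple card_ord.
apply: (card_le_covering_number _ _ _ _ _ _ (@word_map X r f k))
  => [u|c u v cu cv].
  exact: word_ball_word_map.
(* By separation, it suffices that the two values at [xstar] are less than [delta] apart. *)
apply: contrapT => /word_sep; apply/negP; rewrite -ltNge.
have := le_lt_trans (mdist_le_dist_sup _ _ _ _ xstar) cu.
have := le_lt_trans (mdist_le_dist_sup _ _ _ _ xstar) cv.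
rewrite !lte_fin => cv' cu'.
(* Go through the value of the center at [xstar]: each leg is shorter than [eps], hence than
   [delta / 2]. *)
apply: (le_lt_trans (metric_triangle _ (c xstar) _)).
rewrite metric_sym [ltRHS]splitr.
by apply: ltrD; apply: lt_trans eps_lt.
Qed.
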